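(* Let $f:\mathbb{R}^m\to\mathbb{R}$ be convex and differentiable with $L$-Lipschitz continuous gradient (with respect to $\|\cdot\|_2$), and let $x^*$ be a minimizer of $f$. Suppose that, for some $\mu>0$, $f$ is $\mu$-strongly convex or, more generally, satisfies the Polyak–Łojasiewicz condition $\|\nabla f(x)\|_2^2\ge 2\mu\,(f(x)-f(x^* ))$ for all $x\in\mathbb{R}^m$. Let $(x^k),(y^k),(v^k),(a_k),(A_k)$ be generated by the algorithm AGMsDR described in the context (in either variant (a) or variant (b); the algorithm does not use the value of $\mu$). Then for every $k\ge 0$ \[ f(x^{k+1})-f(x^* )\;\le\;\prod_{i=0}^{k-1}\Bigl(1-\frac{\mu}{\hat L_i}\Bigr)\cdot\bigl(f(x^0)-f(x^* )\bigr),\qquad \hat L_i=\frac{A_i+a_{i+1}}{a_{i+1}^2}. \]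
   Context: Algorithm AGMsDR (Accelerated Gradient Method with Small-Dimensional Relaxation). Given a starting point $x^0\in\mathbb{R}^m$, set $v^0=x^0$, $A_0=0$, $\psi_0(x)=\frac12\|x-x^0\|_2^2$. For $k=0,1,2,\dots$: 1. $\beta_k\in\arg\min_{\beta\in[0,1]} f\bigl(v^k+\beta(x^k-v^k)\bigr)$ and $y^k=v^k+\beta_k(x^k-v^k)$. 2. Variant (a) ($L$ known): $x^{k+1}=\arg\min_{x\in\mathbb{R}^m}\{f(y^k)+\langle\nabla f(y^k),x-y^k\rangle+\frac L2\|x-y^k\|_2^2\}$, and $a_{k+1}>0$ is found from $\frac{a_{k+1}^2}{A_k+a_{k+1}}=\frac1L$. Variant (b) (exact line search): $h_{k+1}\in\arg\min_{h\ge0} f\bigl(y^k-h\nabla f(y^k)\bigr)$, $x^{k+1}=y^k-h_{k+1}\nabla f(y^k)$, and $a_{k+1}>0$ is found from $f(y^k)-\frac{a_{k+1}^2}{2(A_k+a_{k+1})}\|\nabla f(y^k)\|_2^2=f(x^{k+1})$. 3. $A_{k+1}=A_k+a_{k+1}$. 4. $\psi_{k+1}(x)=\psi_k(x)+a_{k+1}\{f(y^k)+\langle\nabla f(y^k),x-y^k\rangle\}$ and $v^{k+1}=\arg\min_{x\in\mathbb{R}^m}\psi_{k+1}(x)$. The minimizers in the algorithm are assumed to exist. In variant (b), determining $a_{k+1}$ from its equation presupposes $\nabla f(y^k)\ne0$ at the iterations considered. An empty product equals $1$. *)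

(* Defs.v *)
From HB Require Import structures.
From mathcomp Require Import all_boot all_order all_algebra.
From mathcomp Require Import all_classical all_reals all_analysis.

Set Implicit Arguments.
Unset Strict Implicit.
Unset Printing Implicit Defensive.

Import Order.TTheory GRing.Theory Num.Theory.
Import numFieldNormedType.Exports.

Local Open Scope classical_set_scope.
Local Open Scope ring_scope.

Definition dot (R : realType) (m : nat) (u v : 'rV[R]_m) : R :=
  \sum_i u 0 i * v 0 i.

(* The library norm `|u| on 'rV[R]_m is the sup norm, so the Euclidean norm
   is defined separately; both induce the same topology, hence the same notion
   of differentiability. *)
Definition enorm (R : realType) (m : nat) (u : 'rV[R]_m) : R :=
  Num.sqrt (dot u u).

(* For f differentiable at x, 'D_v f x = dot (grad f x) v. *)
Definition grad (R : realType) (m : nat) (f : 'rV[R]_m -> R) (x : 'rV[R]_m) :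
    'rV[R]_m :=
  \row_i 'D_(delta_mx 0 i) f x.

Definition lipschitz_grad (R : realType) (m : nat) (L : R)
    (f : 'rV[R]_m -> R) : Prop :=
  forall x y, enorm (grad f x - grad f y) <= L * enorm (x - y).

Definition strongly_convex (R : realType) (m : nat) (mu : R)
    (f : 'rV[R]_m -> R) : Prop :=
  forall (x y : 'rV[R]_m) (t : R), 0 <= t <= 1 ->
    f (t *: x + (1 - t) *: y)
    <= t * f x + (1 - t) * f y - mu / 2 * t * (1 - t) * enorm (x - y) ^+ 2.

Definition is_argmin (R : realType) (T : Type) (D : set T) (g : T -> R)
    (x : T) : Prop :=
  D x /\ forall z, D z -> g x <= g z.

Definition polyak_lojasiewicz (R : realType) (m : nat) (mu : R)
    (f : 'rV[R]_m -> R) (xstar : 'rV[R]_m) : Prop :=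
  forall x, 2 * mu * (f x - f xstar) <= enorm (grad f x) ^+ 2.

Definition linearization (R : realType) (m : nat) (f : 'rV[R]_m -> R)
    (y x : 'rV[R]_m) : R :=
  f y + dot (grad f y) (x - y).

Fixpoint psi (R : realType) (m : nat) (f : 'rV[R]_m -> R) (x0 : 'rV[R]_m)
    (y : nat -> 'rV[R]_m) (a : nat -> R) (k : nat) (x : 'rV[R]_m) : R :=
  match k with
  | 0 => 1 / 2 * enorm (x - x0) ^+ 2
  | k'.+1 => psi f x0 y a k' x + a k'.+1 * linearization f (y k') x
  end.

Inductive agmsdr_variant := KnownL | ExactLineSearch.

(* Step 2 of an iteration: from yk and Ak to x' = x^{k+1} and a' = a_{k+1}.
   With exact line search the equation for a' determines it only if the
   gradient at yk is nonzero, so this is part of performing the step. *)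
Definition agmsdr_step2 (R : realType) (m : nat) (var : agmsdr_variant)
    (f : 'rV[R]_m -> R) (L : R) (yk : 'rV[R]_m) (Ak : R)
    (x' : 'rV[R]_m) (a' : R) : Prop :=
  match var with
  | KnownL =>
      [/\ is_argmin setT
            (fun x => linearization f yk x + L / 2 * enorm (x - yk) ^+ 2) x',
          0 < a' &
          a' ^+ 2 / (Ak + a') = 1 / L]
  | ExactLineSearch =>
      [/\ grad f yk != 0,
          exists2 h : R,
            is_argmin [set h : R | 0 <= h] (fun h => f (yk - h *: grad f yk)) h
            & x' = yk - h *: grad f yk,
          0 < a' &
          f yk - a' ^+ 2 / (2 * (Ak + a')) * enorm (grad f yk) ^+ 2 = f x']
  end.

Record agmsdr_iteration (R : realType) (m : nat) (var : agmsdr_variant)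
    (f : 'rV[R]_m -> R) (L : R) (x y v : nat -> 'rV[R]_m) (a A : nat -> R)
    (k : nat) : Prop := AgmsdrIteration {
  agmsdr_y : exists2 beta : R,
    is_argmin [set beta : R | 0 <= beta <= 1]
      (fun beta => f (v k + beta *: (x k - v k))) beta
    & y k = v k + beta *: (x k - v k);
  agmsdr_xa : agmsdr_step2 var f L (y k) (A k) (x k.+1) (a k.+1);
  agmsdr_A : A k.+1 = A k + a k.+1;
  agmsdr_v : is_argmin setT (psi f (x 0%N) y a k.+1) (v k.+1) }.

(* The first N iterations (k = 0, ..., N - 1) have been performed from the
   starting point x 0; entries of the sequences beyond these iterations, as
   well as the unused a 0, are unconstrained. *)
Record agmsdr_run (R : realType) (m : nat) (var : agmsdr_variant)
    (f : 'rV[R]_m -> R) (L : R) (x y v : nat -> 'rV[R]_m) (a A : nat -> R)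
    (N : nat) : Prop := AgmsdrRun {
  agmsdr_v0 : v 0%N = x 0%N;
  agmsdr_A0 : A 0%N = 0;
  agmsdr_iter : forall k, (k < N)%N ->
    agmsdr_iteration var f L x y v a A k }.

Definition Lhat (R : realType) (a A : nat -> R) (i : nat) : R :=
  (A i + a i.+1) / a i.+1 ^+ 2.

(* Main.v *)
(** With c_k = 1 / Lhat_k, both variants of step 2 decrease f by at least
    (c_k / 2) |grad f (y_k)|^2: variant (b) by the choice of a_{k+1}, variant (a)
    because c_k = 1 / L and by the descent lemma.  The PL inequality turns this
    into f (x_{k+1}) - fmin <= (1 - mu c_k) (f (y_k) - fmin), and beta = 1 is
    admissible in the line search, so f (y_k) <= f (x_k).  Chaining these bounds
    needs 1 - mu c_k >= 0, which holds unless f is constant. *)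

Require Import Defs.
From HB Require Import structures.
From mathcomp Require Import all_boot all_order all_algebra.
From mathcomp Require Import all_classical all_reals all_analysis.
From mathcomp Require Import ring lra.

Import Order.TTheory GRing.Theory Num.Theory.
Import numFieldNormedType.Exports.

Local Open Scope classical_set_scope.
Local Open Scope ring_scope.

(** * Euclidean inner product and norm *)

Section Dot.
Set Implicit Arguments.
Unset Strict Implicit.
Context {R : realType} {m : nat}.
Implicit Types u v w : 'rV[R]_m.

Lemma dotC u v : dot u v = dot v u.
Proof. by apply: eq_bigr => i _; rewrite mulrC. Qed.

Lemma dotDl u v w : dot (u + v) w = dot u w + dot v w.
Proof. by rewrite -big_split; apply: eq_bigr => i _; rewrite mxE mulrDl. Qed.

Lemma dotZl c u v : dot (c *: u) v = c * dot u v.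
Proof. by rewrite /dot mulr_sumr; apply: eq_bigr => i _; rewrite mxE mulrA. Qed.

Lemma dotBl u v w : dot (u - v) w = dot u w - dot v w.
Proof. by rewrite dotDl -scaleN1r dotZl mulN1r. Qed.

Lemma dotBr u v w : dot u (v - w) = dot u v - dot u w.
Proof. by rewrite dotC dotBl !(dotC u). Qed.

Lemma dotZr c u v : dot u (c *: v) = c * dot u v.
Proof. by rewrite dotC dotZl dotC. Qed.

Lemma dot_ge0 u : 0 <= dot u u.
Proof. by apply: sumr_ge0 => i _; rewrite -expr2 sqr_ge0. Qed.

Lemma dot_gt0 u : u != 0 -> 0 < dot u u.
Proof.
move=> u0; rewrite lt_neqAle dot_ge0 andbT eq_sym.
apply: contraNneq u0 => /eqP; rewrite psumr_eq0 => [/allP u0|i _]; last first.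
  by rewrite -expr2 sqr_ge0.
apply/eqP/rowP => i; rewrite mxE; apply/eqP.
by have := u0 i (mem_index_enum i); rewrite mulf_eq0 orbb.
Qed.

Lemma enorm_sqr u : enorm u ^+ 2 = dot u u.
Proof. by rewrite sqr_sqrtr ?dot_ge0. Qed.

(** Expanding |u - c v|^2 >= 0 gives 2c<u,v> <= |u|^2 + c^2 |v|^2 <= 2 c^2 |v|^2; this takes the
    place of Cauchy-Schwarz. *)
Lemma dot_le_scale c u v :
  0 < c -> enorm u <= c * enorm v -> dot u v <= c * dot v v.
Proof.
move=> c0 uv; have : enorm u ^+ 2 <= (c * enorm v) ^+ 2.
  by rewrite ler_sqr // nnegrE ?mulr_ge0 ?sqrtr_ge0 // ltW.
rewrite exprMn !enorm_sqr => uu.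
have := dot_ge0 (u - c *: v).
rewrite dotBl !dotBr !dotZl !dotZr (dotC v u) => uv0.
by rewrite -(ler_pM2l c0); lra.
Qed.

End Dot.

(** * Consequences of smoothness, strong convexity and the PL inequality *)

Section Descent.
Set Implicit Arguments.
Unset Strict Implicit.
Context {R : realType} {m : nat}.
Implicit Types (f : 'rV[R]_m -> R) (x y d : 'rV[R]_m).

Lemma derive_dot_grad f x d : differentiable f x -> 'D_d f x = dot (grad f x) d.
Proof.
move=> fx; rewrite deriveE // [in LHS](row_sum_delta d) linear_sum.
by apply: eq_bigr => i _; rewrite linearZ mxE deriveE // mulrC.
Qed.

Lemma is_derive_line f y d (t : R) : differentiable f (y + t *: d) ->
  is_derive t 1 (fun s => f (y + s *: d)) (dot (grad f (y + t *: d)) d).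
Proof.
move=> fd; have : derivable f (y + t *: d) d := diff_derivable fd.
have := derive_dot_grad d fd.
rewrite /derive /derivable => <- fdc.
(* The difference quotient of f in direction [d] and that of its restriction to the line are the
   same function of [h]. *)
have E : (fun h : R => h^-1 *: ((f \o shift (y + t *: d)) (h *: d)
                           - f (y + t *: d)))
       = (fun h : R => h^-1 *: (((fun s => f (y + s *: d)) \o shift t) (h *: 1)
                           - f (y + t *: d))).
  apply/funext => h /=; congr (_ *: (f _ - _)).
  by rewrite -[h *: 1]/(h * 1) mulr1 scalerDl addrCA.
by split; rewrite /derivable /derive -E.
Qed.

Lemma descent_lemma f (L : R) x y :
  (forall z, differentiable f z) -> 0 < L -> lipschitz_grad L f ->
  f x <= linearization f y x + L / 2 * enorm (x - y) ^+ 2.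
Proof.
move=> fd L0 fL; rewrite enorm_sqr /linearization.
set d := x - y; set g := dot (grad f y) d; set q := L / 2 * dot d d.
pose F : R -> R := fun s => f (y + s *: d).
(* The claim is [phi 1 <= phi 0]; by the mean value theorem it suffices that the derivative of [phi]
   is nonpositive on [0, 1]. *)
pose phi : R -> R := F - g *: id - q *: id ^+ 2.
have dphi (t : R) : is_derive t 1 phi
    (dot (grad f (y + t *: d)) d - g - 2 * q * t).
  have dF := @is_derive_line f y d t (fd _).
  apply: is_derive_eq; rewrite /= /GRing.scale /=.
  by rewrite !mulr1; ring.
have cphi : {within `[0, 1], continuous phi}.
  by apply: derivable_within_continuous => t _; case: (dphi t).
have [c] := MVT_segment ler01 (fun t _ => dphi t) cphi.
rewrite in_itv /= => /andP[c0 _].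
have F1 : F 1 = f x by rewrite /F scale1r subrKC.
have F0 : F 0 = f y by rewrite /F scale0r addr0.
rewrite /phi !fctE /= F1 F0 subr0 /GRing.scale /= => E.
suff : dot (grad f (y + c *: d)) d - g - 2 * q * c <= 0.
  by lra.
(* The mean value point may be 0, where the derivative vanishes; [dot_le_scale] needs the constant
   [L * c] to be positive. *)
move: c0; rewrite le_eqVlt => /orP[/eqP <-|c0].
  by rewrite scale0r addr0 subrr mulr0 subrr.
rewrite -dotBl subr_le0 /q mulrCA mulrA divfK ?pnatr_eq0 // mulrAC.
apply: dot_le_scale; first exact: mulr_gt0.
apply: le_trans (fL _ _) _.
rewrite addrC addKr /enorm dotZl dotZr mulrA -expr2 sqrtrM ?sqr_ge0 //.
by rewrite sqrtr_sqr (ger0_norm (ltW c0)) mulrA.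
Qed.

Lemma gradient_step_model f (L : R) y : L != 0 ->
  let x := y - L^-1 *: grad f y in
  linearization f y x + L / 2 * enorm (x - y) ^+ 2
  = f y - L^-1 / 2 * enorm (grad f y) ^+ 2.
Proof.
move=> L0 /=; rewrite /linearization !enorm_sqr [_ - _ - y]addrC addKr.
by rewrite -scaleNr dotZr dotZl dotZr; field.
Qed.

(** The descent lemma bounds [f x'] by the model at [x'], which is at most the model at the explicit
    gradient step; the argmin itself is never computed. *)
Lemma gradient_step_decrease f (L : R) y :
  (forall z, differentiable f z) -> 0 < L -> lipschitz_grad L f ->
  forall x', is_argmin setT
    (fun x => linearization f y x + L / 2 * enorm (x - y) ^+ 2) x' ->
  f x' <= f y - L^-1 / 2 * enorm (grad f y) ^+ 2.
Proof.
move=> fd L0 fL x' [_ /(_ (y - L^-1 *: grad f y) I)].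
have := @descent_lemma f L x' y fd L0 fL => /le_trans /[apply].
by rewrite gradient_step_model // gt_eqF.
Qed.

Lemma strongly_convex_lower_bound f (mu : R) x y :
  differentiable f y -> strongly_convex mu f ->
  f y + dot (grad f y) (x - y) + mu / 2 * dot (x - y) (x - y) <= f x.
Proof.
move=> fy fmu; set d := x - y.
set q := mu / 2 * dot d d.
(* Strong convexity on the segment, divided by h, bounds the difference quotient by f x - f y - q (1
   - h). Moving q h to the left makes the bound constant, and h tends to 0 from the right. *)
have qc : h^-1 *: ((f \o shift y) (h *: d) - f y) - q * h @[h --> 0^'+]
    --> dot (grad f y) d - q * 0.
  rewrite -derive_dot_grad //; apply: cvgB.
    exact: cvg_dnbhs_at_right (diff_derivable fy).
  by apply: cvgMr; apply: cvg_at_right_filter.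
suff : dot (grad f y) d - q * 0 <= f x - f y - q by rewrite mulr0; lra.
rewrite -(cvg_lim _ qc) //; apply: limr_le; first by apply: cvgP qc.
near=> h.
have h0 : 0 < h by near: h; exact: nbhs_right_gt.
have h1 : h <= 1 by near: h; exact: nbhs_right_le.
have := fmu x y h; rewrite (ltW h0) h1 enorm_sqr -/d => /(_ isT).
have -> : h *: x + (1 - h) *: y = h *: d + y.
  by rewrite /d scalerBr scalerBl scale1r addrA addrAC.
rewrite /= => H.
rewrite -[_^-1 *: _]/(_^-1 * _) lerBlDr ler_pdivrMl //.
by rewrite /q; move: H; lra.
Unshelve. all: by end_near.
Qed.

Lemma strongly_convex_polyak_lojasiewicz f (mu : R) xstar :
  0 < mu -> (forall z, differentiable f z) -> strongly_convex mu f ->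
  polyak_lojasiewicz mu f xstar.
Proof.
move=> mu0 fd fmu y; rewrite enorm_sqr.
have := @strongly_convex_lower_bound f mu xstar y (fd y) fmu.
move: (xstar - y) (grad f y) => d g.
(* |g + mu d|^2 >= 0 says that the quadratic lower bound, as a function of d, never falls below f y
   - |g|^2 / (2 mu). *)
have := dot_ge0 (g - (- mu) *: d).
rewrite dotBl !dotBr !dotZl !dotZr (dotC d g).
move=> gd H.
have : 2 * mu * (f y + dot g d + mu / 2 * dot d d)
    <= 2 * mu * f xstar by rewrite ler_pM2l ?mulr_gt0.
by lra.
Qed.

Lemma polyak_lojasiewicz_decrease f (mu c : R) xstar x' y :
  0 <= c -> polyak_lojasiewicz mu f xstar ->
  f x' <= f y - c / 2 * enorm (grad f y) ^+ 2 ->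
  f x' - f xstar <= (1 - mu * c) * (f y - f xstar).
Proof.
move=> c0 /(_ y) H dec.
have := ler_wpM2l (divr_ge0 c0 (ler0n R 2)) H.
by lra.
Qed.

(* At a point y with f y > f xstar a negative contraction factor would put
   f x' below the minimum. *)
Lemma contraction_factor_ge0 f (mu c : R) xstar x' y :
  0 <= c -> polyak_lojasiewicz mu f xstar -> f xstar <= f x' ->
  f xstar < f y -> f x' <= f y - c / 2 * enorm (grad f y) ^+ 2 ->
  0 <= 1 - mu * c.
Proof.
move=> c0 pl x'_min y_gt dec.
have := polyak_lojasiewicz_decrease c0 pl dec.
move=> H; have : 0 <= (1 - mu * c) * (f y - f xstar) by lra.
by rewrite pmulr_lge0 // subr_gt0.
Qed.

End Descent.

(** * Iterations of AGMsDR *)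

Section AGMsDR.
Set Implicit Arguments.
Unset Strict Implicit.
Context {R : realType} {m : nat} {f : 'rV[R]_m -> R} {L mu : R}
  {xstar : 'rV[R]_m} {var : agmsdr_variant}
  {x y v : nat -> 'rV[R]_m} {a A : nat -> R} {N : nat}.
Hypotheses (f_diff : forall z, differentiable f z) (L_gt0 : 0 < L)
  (f_smooth : lipschitz_grad L f) (xstar_min : is_argmin setT f xstar)
  (f_pl : polyak_lojasiewicz mu f xstar)
  (run : agmsdr_run var f L x y v a A N).

Lemma agmsdr_a_gt0 k : (k < N)%N -> 0 < a k.+1.
Proof. by move=> /(agmsdr_iter run)[_]; case: (var) => -[]. Qed.

Lemma agmsdr_A_ge0 k : (k <= N)%N -> 0 <= A k.
Proof.
elim: k => [|k IH] kN; first by rewrite (agmsdr_A0 run).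
rewrite (agmsdr_A (agmsdr_iter run kN)).
by rewrite addr_ge0 ?IH ?(ltW (agmsdr_a_gt0 kN)) // ltnW.
Qed.

Lemma Lhat_gt0 k : (k < N)%N -> 0 < Lhat a A k.
Proof.
move=> kN; have a0 := agmsdr_a_gt0 kN.
by rewrite divr_gt0 ?exprn_gt0 // ltr_wpDl // agmsdr_A_ge0 // ltnW.
Qed.

Lemma agmsdr_y_le k : (k < N)%N -> f (y k) <= f (x k).
Proof.
move=> /(agmsdr_iter run)[[beta [_ beta_min] ->] _ _ _].
have /beta_min : [set beta : R | 0 <= beta <= 1] 1 by rewrite /= ler01 lexx.
by rewrite scale1r subrKC.
Qed.

Lemma agmsdr_decrease k : (k < N)%N ->
  f (x k.+1) <= f (y k) - (Lhat a A k)^-1 / 2 * enorm (grad f (y k)) ^+ 2.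
Proof.
move=> kN; have [_ + _ _] := agmsdr_iter run kN.
(* In variant (b) the equation defining a_{k+1} is this bound with equality. *)
rewrite /Lhat invf_div; case: (var) => /= [[xmin _ ->]|[_ _ _ <-]].
  by rewrite div1r; apply: gradient_step_decrease.
by rewrite [2 * _]mulrC invfM [_ ^+ 2 * (_ / 2)]mulrA.
Qed.

Lemma agmsdr_xS_le_y k : (k < N)%N -> f (x k.+1) <= f (y k).
Proof.
move=> kN; apply: le_trans (agmsdr_decrease kN) _.
by rewrite gerBl mulr_ge0 ?sqr_ge0 // divr_ge0 // invr_ge0 ltW // Lhat_gt0.
Qed.

(** [contraction_factor_ge0] needs a point strictly above the minimum from which a step decreases f
    by the right amount; the two variants find it differently. *)
Lemma agmsdr_factor_ge0 k : (k < N)%N ->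
  (exists z, f xstar < f z) -> 0 <= 1 - mu / Lhat a A k.
Proof.
move=> kN [z z_gt]; have c0 : 0 <= (Lhat a A k)^-1.
  by rewrite invr_ge0 ltW // Lhat_gt0.
have [_ + _ _] := agmsdr_iter run kN; case varE: (var) => /=.
  move=> [_ _ aE].
  have LhatE : (Lhat a A k)^-1 = L^-1 by rewrite /Lhat invf_div aE div1r.
  (* Here [y k] may already be a minimizer. But the factor is 1 - mu / L, the same at every point,
     so a gradient step from [z] can serve instead. *)
  have [x' dec] : exists x', f x' <= f z - L^-1 / 2 * enorm (grad f z) ^+ 2.
    exists (z - L^-1 *: grad f z).
    apply: le_trans (@descent_lemma _ _ f L _ z f_diff L_gt0 f_smooth) _.
    by rewrite gradient_step_model // gt_eqF.
  rewrite LhatE in c0 *.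
  exact: (contraction_factor_ge0 c0 f_pl (xstar_min.2 x' I) z_gt dec).
move=> [g0 _ _ _].
(* Here the gradient at [y k] is nonzero, so f decreases strictly from [y k], which therefore lies
   above the minimum. *)
have dec := agmsdr_decrease kN.
apply: (contraction_factor_ge0 c0 f_pl (xstar_min.2 _ I) _ dec).
apply: le_lt_trans (xstar_min.2 (x k.+1) I) _; apply: le_lt_trans dec _.
rewrite ltrBlDr ltrDl mulr_gt0 //; last by rewrite enorm_sqr dot_gt0.
by rewrite divr_gt0 // invr_gt0 Lhat_gt0.
Qed.

Lemma agmsdr_rate k : (k <= N)%N -> (exists z, f xstar < f z) ->
  f (x k) - f xstar
  <= \prod_(0 <= i < k) (1 - mu / Lhat a A i) * (f (x 0%N) - f xstar).
Proof.
move=> + nconst; elim: k => [|k IH] kN; first by rewrite big_geq // mul1r.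
have c0 : 0 <= (Lhat a A k)^-1 by rewrite invr_ge0 ltW // Lhat_gt0.
have := polyak_lojasiewicz_decrease c0 f_pl (agmsdr_decrease kN).
move=> /le_trans; apply.
rewrite big_nat_recr //= mulrAC [leRHS]mulrC.
apply: ler_wpM2l; first exact: agmsdr_factor_ge0.
by apply: le_trans (IH (ltnW kN)); rewrite lerD2r agmsdr_y_le.
Qed.

End AGMsDR.

Theorem mainTheorem1 (R : realType) (m : nat) (f : 'rV[R]_m -> R)
    (L mu : R) (xstar : 'rV[R]_m) (var : agmsdr_variant)
    (x y v : nat -> 'rV[R]_m) (a A : nat -> R) (N : nat)
    (f_convex : convex_function [set: 'rV[R]_m] f)
    (f_diff : forall z, differentiable f z)
    (L_gt0 : 0 < L)
    (f_smooth : lipschitz_grad L f)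
    (xstar_min : is_argmin setT f xstar)
    (mu_gt0 : 0 < mu)
    (f_growth : strongly_convex mu f \/ polyak_lojasiewicz mu f xstar)
    (run : agmsdr_run var f L x y v a A N) :
  forall k, (k < N)%N ->
    f (x k.+1) - f xstar
    <= \prod_(0 <= i < k) (1 - mu / Lhat a A i) * (f (x 0%N) - f xstar).
Proof.
have f_pl : polyak_lojasiewicz mu f xstar.
  by case: f_growth => // ?; apply: strongly_convex_polyak_lojasiewicz.
move=> k kN; have [nconst|const] := pselect (exists z, f xstar < f z).
  (* The k factors are already earned at [x k]; the passage to [x k.+1] only has to not increase
     f. *)
  apply: le_trans (agmsdr_rate f_diff L_gt0 f_smooth xstar_min f_pl run
    (ltnW kN) nconst).
  rewrite lerD2r; apply: le_trans (agmsdr_y_le run kN).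
  exact: agmsdr_xS_le_y f_diff L_gt0 f_smooth run _ kN.
(* For constant f the factors may be negative, but both sides are 0. *)
have fE z : f z = f xstar.
  apply/le_anti; rewrite xstar_min.2 // andbT leNgt.
  by apply/negP => z_gt; apply: const; exists z.
by rewrite !fE subrr mulr0.
Qed.
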